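(* Let $P$ be an arbitrary (not necessarily finite) poset and let $f$ be a conservative choice function on $P$. Then $f$ is the union of some elementary choice functions associated with well sequences compatible with $f$; that is, there is a family $(A_\lambda)_{\lambda\in\Lambda}$ of well sequences in $P$, each compatible with $f$, such that $f(X)=\bigcup_{\lambda\in\Lambda} f_{A_\lambda}(X)$ for every ideal $X$ of $P$.
   Context: An (order) ideal of a poset $P$ is a subset $X\subseteq P$ such that $x\in X$, $y\le x$ imply $y\in X$; $\mathcal I(P)$ is the set of all ideals (including $\emptyset$ and $P$). For $S\subseteq P$, $I(S)=\{y\in P : y\le s\text{ for some }s\in S\}$ is the ideal generated by $S$, and for $a\in P$, $F(a)=\{y\in P: y\ge a\}$. A choice function (CF) on $P$ is a map $f:\mathcal I(P)\to\mathcal I(P)$ with $f(X)\subseteq X$ for every ideal $X$. It has the heredity property if for all ideals $A\subseteq B$ one has $f(B)\cap A\subseteq f(A)$. It has the outcast property if for all ideals $A,B$ with $f(B)\subseteq A\subseteq B$ one has $f(A)=f(B)$. A CF is conservative if it has both the heredity and the outcast properties. A well sequence in $P$ is a family $A=(a_i)_{i\in I}$ of elements of $P$ indexed by a (possibly empty) well-ordered set $(I,\prec)$. The elementary CF $f_A$ associated with $A$ is defined as follows: for an ideal $X$, if there is $i\in I$ with $a_i\in X$, let $i$ be the $\prec$-least such index and put $f_A(X)=X\cap I(\{a_j : j\preceq i\})$; if no $a_i$ belongs to $X$, put $f_A(X)=X\cap I(\{a_j: j\in I\})$. The well sequence $A=(a_i)_{i\in I}$ is compatible with a CF $f$ if $a_i\in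 f\bigl(P\setminus\bigcup_{j\prec i}F(a_j)\bigr)$ for every $i\in I$. Unions of CFs are taken pointwise. *)

(* Defs.v *)
From mathcomp Require Import all_boot all_order.
From mathcomp Require Import boolp classical_sets.
From mathcomp Require wochoice.

Set Implicit Arguments.
Unset Strict Implicit.
Unset Printing Implicit Defensive.

Import Order.TTheory.
Local Open Scope order_scope.
Local Open Scope classical_set_scope.

Section Ideals.
Context {d : Order.disp_t} (P : porderType d).

(* Ideals are bundled, so that a choice function is exactly a map on ideals
   and carries no values on other subsets of P. The ideal I(S) generated by S
   is the library's [down S]. *)
Record ideal := Ideal {
  ideal_set :> set P;
  ideal_closed : forall x y : P, ideal_set x -> y <= x -> ideal_set y
}.

Definition up (a : P) : set P := [set y | a <= y].

Record choice_function := ChoiceFunction {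
  cf_fun :> ideal -> ideal;
  cf_sub : forall X : ideal, cf_fun X `<=` X
}.

Definition heredity (f : choice_function) : Prop :=
  forall A B : ideal, A `<=` B -> f B `&` A `<=` f A.

Definition outcast (f : choice_function) : Prop :=
  forall A B : ideal, f B `<=` A -> A `<=` B -> f A = f B :> set P.

Definition conservative (f : choice_function) : Prop :=
  heredity f /\ outcast f.

(* The index set may be empty, and the family need not be injective.
   [ws_le] is the reflexive order on indices; [wochoice.well_order] asks every
   nonempty subset to have a unique minimum, which makes it a total order. *)
Record well_sequence := WellSequence {
  ws_index : Type;
  ws_le : rel ws_index;
  ws_wo : wochoice.well_order ws_le;
  ws_fun :> ws_index -> P
}.

Definition ws_lt (A : well_sequence) (j i : ws_index A) : Prop :=
  ws_le j i /\ j <> i.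

Definition least_index (A : well_sequence) (X : ideal) (i : ws_index A) : Prop :=
  ideal_set X (A i) /\ forall j, ideal_set X (A j) -> ws_le i j.

Lemma ex_least_index (A : well_sequence) (X : ideal) :
  (exists i : ws_index A, ideal_set X (A i)) -> {i : ws_index A | least_index X i}.
Proof.
move=> Xne; apply: cid.
have [|i [[/asboolP Xi imin] _]] := ws_wo (w := A)
  (A := fun i => `[< ideal_set X (A i) >]).
  by case: Xne => i Xi; exists i; apply/asboolP.
by exists i; split=> // j Xj; apply: imin; apply/asboolP.
Qed.

Definition elementary_set (A : well_sequence) (X : ideal) : set P :=
  match pselect (exists i, ideal_set X (A i)) with
  | left AX => let i := sval (ex_least_index AX) in
               X `&` down (A @` [set j | ws_le j i])
  | right _ => X `&` down (range A)
  end.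

Lemma elementary_set_closed (A : well_sequence) (X : ideal) (x y : P) :
  elementary_set A X x -> y <= x -> elementary_set A X y.
Proof.
by rewrite /elementary_set; case: pselect => [AX|_] /= [Xx [a [Aa xa]]] yx;
  split; [exact: ideal_closed Xx yx|exists a; split=> //; exact: le_trans xa
         |exact: ideal_closed Xx yx|exists a; split=> //; exact: le_trans xa].
Qed.

Definition elementary_ideal (A : well_sequence) (X : ideal) : ideal :=
  Ideal (@elementary_set_closed A X).

Lemma elementary_ideal_sub (A : well_sequence) (X : ideal) :
  elementary_ideal A X `<=` X.
Proof. by move=> x /=; rewrite /elementary_set; case: pselect => [AX|_] []. Qed.

Definition elementary (A : well_sequence) : choice_function :=
  ChoiceFunction (@elementary_ideal_sub A).

Definition remaining_set (A : well_sequence) (i : ws_index A) : set P :=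
  ~` \bigcup_(j in [set j | ws_lt j i]) up (A j).

Lemma remaining_set_closed (A : well_sequence) (i : ws_index A) (x y : P) :
  remaining_set i x -> y <= x -> remaining_set i y.
Proof. by move=> nx yx [j ji ajy]; apply: nx; exists j => //; exact: le_trans yx. Qed.

Definition remaining (A : well_sequence) (i : ws_index A) : ideal :=
  Ideal (@remaining_set_closed A i).

Definition compatible (A : well_sequence) (f : choice_function) : Prop :=
  forall i : ws_index A, ideal_set (f (remaining i)) (A i).

End Ideals.

(* Main.v *)
Require Import Defs.
From mathcomp Require Import all_boot all_order.
From mathcomp Require Import boolp classical_sets.
From mathcomp Require wochoice.
Local Open Scope classical_set_scope.

Set Implicit Arguments.
Unset Strict Implicit.

(** Every compatible sequence contributes only elements of f X
    ([compatible_elementary_sub]): the terms a_j that matter for X are preceded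
    by no member of X, so X lies in the ideal R_j that remains at stage j, and
    heredity carries the elements of X below a_j from f R_j into f X.

    Conversely, every x in f X lies in f_A X for some compatible sequence A
    ([compatible_reaching]), and one such A for each pair (X, x) gives the
    family.  The sequence is built greedily: as long as the remaining
    ideal R contains X, either x belongs to f R, and x is taken as the last
    term, or f R is not contained in X, since otherwise the outcast property
    would give f R = f X; then any element of f R outside X is taken, and the
    next remaining ideal still contains X.  The terms taken are pairwise
    distinct, so when the stages are indexed by a well-ordering of the power
    set of P, which cannot be injected into P, the process must end by
    taking x. *)

(** * Well-orders *)

Lemma well_order_anti (W : Type) (le : rel W) (u v : W) :
  wochoice.well_order le -> le u v -> le v u -> u = v.
Proof.
move=> wo uv vu; have /(_ u v) := @wochoice.wo_chain_antisymmetric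
  {classic W} le predT (wochoice.withinW wo).
by apply=> //; rewrite uv vu.
Qed.

Lemma well_order_trans (W : Type) (le : rel W) :
  wochoice.well_order le -> transitive le.
Proof.
move=> wo v u w uv vw.
(* The minimum of {u, v, w} is u unless two of the three points coincide. *)
have [|m [[/asboolP mE mmin] _]] := wo (fun t => `[< t = u \/ t = v \/ t = w >]).
  by exists u; apply/asboolP; left.
have mu : le m u by apply: mmin; apply/asboolP; left.
have mv : le m v by apply: mmin; apply/asboolP; right; left.
have mw : le m w by apply: mmin; apply/asboolP; right; right.
case: mE => [<- //|[mE|mE]]; rewrite {}mE in mu mv mw.
- by rewrite (well_order_anti wo uv mu).
- by rewrite -(well_order_anti wo vw mv).
Qed.

Lemma well_order_lt_wf (W : Type) (le : rel W) :
  wochoice.well_order le -> well_founded (fun v w => le v w /\ v <> w).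
Proof.
move=> wo w; apply: contrapT => naccw.
have [|z [[/asboolP naccz zmin] _]] := wo
    (fun v => `[< ~ Acc (fun v w => le v w /\ v <> w) v >]).
  by exists w; apply/asboolP.
apply: naccz; constructor=> v [vz nvz]; apply: contrapT => naccv.
apply: nvz; apply: (well_order_anti wo vz).
by apply: zmin; apply/asboolP.
Qed.

Lemma well_order_preimage (V W : Type) (g : V -> W) (le : rel W) :
  injective g -> wochoice.well_order le ->
  wochoice.well_order (fun u v => le (g u) (g v)).
Proof.
move=> ginj wo A [v0 Av0].
have [|_ [[/asboolP[v [Av <-]] vmin] vuniq]] := wo
    (fun w => `[< exists v, v \in A /\ g v = w >]).
  by exists (g v0); apply/asboolP; exists v0.
exists v; split=> [|u [Au umin]].
  by split=> // u Au; apply: vmin; apply/asboolP; exists u.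
apply: ginj; apply: vuniq; split; first by apply/asboolP; exists u.
by move=> _ /asboolP[t [At <-]]; exact: umin.
Qed.

Lemma cantor_injection (T : Type) (h : set T -> T) : ~ injective h.
Proof.
move=> hinj; pose D := [set p | exists S, h S = p /\ ~ S p].
have nD : ~ D (h D).
  by move=> DhD; have [S [/hinj SD]] := DhD; rewrite SD.
by apply: (nD); exists D.
Qed.

Section CompatibleSequences.
Context {d : Order.disp_t} {P : porderType d}.
Implicit Types (f : choice_function P) (A : well_sequence P) (X : ideal P).

(** * Compatible sequences stay inside the choice function *)

Lemma sub_remaining A X (i : ws_index A) :
  (forall j, ws_lt j i -> ~ ideal_set X (A j)) -> X `<=` remaining i.
Proof.
move=> nX y Xy [j ji ajy]; apply: (nX j ji).
exact: ideal_closed Xy ajy.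
Qed.

Lemma sub_remaining_least A X (i j : ws_index A) :
  least_index X i -> ws_le j i -> X `<=` remaining j.
Proof.
move=> [_ imin] ji; apply: sub_remaining => k [kj nkj] /imin ik; apply: nkj.
have wo := ws_wo (w := A).
apply: (well_order_anti wo kj); exact: (well_order_trans wo ji ik).
Qed.

Lemma compatible_elementary_sub f A X :
  heredity f -> compatible A f -> elementary A X `<=` f X.
Proof.
move=> her comp x.
have below j : X `<=` remaining j -> ideal_set X x -> (x <= A j)%O ->
    ideal_set (f X) x.
  move=> XR Xx xj; apply: (her _ _ XR); split=> //.
  exact: ideal_closed (comp j) xj.
rewrite /= /elementary_set; case: pselect => [AX [Xx]|nAX [Xx]] /=.
- case: ex_least_index => i imin /= [_ [[j ji <-] xj]].
  by apply: (below j) => //; exact: sub_remaining_least imin ji.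
- move=> [_ [[j _ <-] xj]]; apply: (below j) => //.
  by apply: sub_remaining => k _ Xk; apply: nAX; exists k.
Qed.

(** * Greedy sequences *)

Lemma ideal_ext (X Y : ideal P) : X = Y :> set P -> X = Y.
Proof.
case: X Y => [X cX] [Y cY] /= XY; move: cX cY; rewrite XY => cX cY.
by congr Ideal; exact: Prop_irrelevance.
Qed.

(** Transfinite recursion: the remaining ideal at stage w depends only on the
    terms before w. *)
Lemma greedy_sequence (W : Type) (le : rel W) (wo : wochoice.well_order le)
    (c : ideal P -> P) :
  exists a : W -> P, forall w, a w = c (remaining (A := WellSequence wo a) w).
Proof.
pose lt v w := le v w /\ v <> w.
have closed w (rec : forall v, lt v w -> P) x y :
    (~ exists v (vw : lt v w), rec v vw <= x)%O -> (y <= x)%O ->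
    (~ exists v (vw : lt v w), rec v vw <= y)%O.
  by move=> nx yx [v [vw vy]]; apply: nx; exists v, vw; exact: Order.le_trans yx.
pose step w rec := c (Ideal (closed w rec)).
exists (Fix (well_order_lt_wf wo) _ step) => w.
rewrite Fix_eq; last first.
  move=> v r s rs; congr step.
  by apply/functional_extensionality_dep => u; apply/functional_extensionality_dep.
congr c; apply: ideal_ext; apply/seteqP; split=> y /= ny.
- by move=> [v vw vy]; apply: ny; exists v, vw.
- by move=> [v [vw vy]]; apply: ny; exists v.
Qed.

Definition initial_segment A (w : ws_index A) : well_sequence P :=
  WellSequence
    (well_order_preimage (@val_inj _ _ {v | ws_le v w}) (ws_wo (w := A)))
    (fun v => A (sval v)).

Lemma remaining_initial_segment A (w : ws_index A)
    (v : ws_index (initial_segment w)) :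
  remaining v = remaining (sval v).
Proof.
apply: ideal_ext; apply/seteqP; split=> y nRy [j [jv njv] ajy].
- have jw : ws_le j w.
    exact: (well_order_trans (ws_wo (w := A)) jv (svalP v)).
  apply: nRy; exists (exist _ j jw) => //; split=> // jvE.
  by apply: njv; rewrite -jvE.
- apply: nRy; exists (sval j) => //; split=> // jvE.
  by apply: njv; exact: val_inj.
Qed.

(** The outcast property keeps the greedy construction going: if f R were
    contained in X without containing x, then f R = f X would contain x. *)
Lemma greedy_choice f X x : outcast f -> ideal_set (f X) x ->
  exists c : ideal P -> P, forall R : ideal P, X `<=` R ->
    ideal_set (f R) (c R) /\ (ideal_set X (c R) -> c R = x).
Proof.
move=> out fXx.
suff /choice[c cP] : forall R : ideal P, exists a, X `<=` R ->
    ideal_set (f R) a /\ (ideal_set X a -> a = x) by exists c.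
move=> R.
have [fRx|nfRx] := EM (ideal_set (f R) x); first by exists x.
have [XR|nXR] := EM (X `<=` R); last by exists x.
have [a [fRa nXa]] : exists a, ideal_set (f R) a /\ ~ ideal_set X a.
  apply: contrapT => nout; apply: nfRx; rewrite -(out X R) // => a fRa.
  by apply: contrapT => nXa; apply: nout; exists a.
by exists a.
Qed.

Lemma compatible_reaching f X x : outcast f -> ideal_set (f X) x ->
  exists2 A, compatible A f & ideal_set (elementary A X) x.
Proof.
move=> out fXx.
have [c cP] := greedy_choice out fXx.
have [le wo] := wochoice.well_ordering_principle (set P).
have [a aE] := greedy_sequence wo c.
pose A := WellSequence wo a.
(* Up to the first stage w at which the term lies in X, the remaining ideals
   contain X, so the terms obey the choice rule; the sequence is cut at w. *)
have [AX|nAX] := EM (exists w : ws_index A, ideal_set X (A w)); last first.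
  (* If the sequence never enters X, each term lies in its remaining ideal,
     hence differs from all earlier terms. *)
  have a_remaining w : ideal_set (remaining (A := A) w) (a w).
    have XR : X `<=` remaining (A := A) w.
      by apply: sub_remaining => v _ Xv; apply: nAX; exists v.
    by apply: (@cf_sub _ _ f); have [] := cP _ XR; rewrite -aE.
  have neq v w : le v w -> a v = a w -> v = w.
    move=> vw avw; apply: contrapT => nvw; apply: (a_remaining w).
    by exists v => //; rewrite /up /= -avw.
  case: (cantor_injection (h := a)) => v w avw.
  have /orP[vw|wv] : le v w || le w v.
    by have := wochoice.wo_chainW (wochoice.withinW (A := predT) wo); apply.
  - exact: neq.
  - by apply/esym; apply: neq.
have [w wleast] := ex_least_index AX.
have stage v : le v w -> ideal_set (f (remaining (A := A) v)) (a v) /\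
    (ideal_set X (a v) -> a v = x).
  move=> vw; have := cP _ (sub_remaining_least wleast vw).
  by rewrite -aE.
exists (initial_segment (A := A) w).
  move=> v; rewrite remaining_initial_segment.
  by have [] := stage _ (svalP v).
have top : le w w.
  by case: wleast => Xw; apply.
rewrite /= /elementary_set; case: pselect => [BX|[]] /=; last first.
  by exists (exist _ w top); case: wleast.
split; first exact: (@cf_sub _ _ f).
case: ex_least_index => i [Xi imin] /=; exists x; split=> //.
exists i; first exact: imin.
by have [_] := stage _ (svalP i); apply.
Qed.

End CompatibleSequences.

Theorem mainTheorem2 (d : Order.disp_t) (P : porderType d)
    (f : choice_function P) (hf : conservative f) :
  exists (L : Type) (A : L -> well_sequence P),
    (forall l : L, compatible (A l) f) /\
    (forall X : ideal P,
       f X = \bigcup_(l in [set: L]) elementary (A l) X :> set P).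
Proof.
have [her out] := hf.
pose L := {p : ideal P * P | ideal_set (f p.1) p.2}.
have /choice[A AP] : forall l : L, exists A,
    compatible A f /\ ideal_set (elementary A (sval l).1) (sval l).2.
  by move=> [[X x] /= /(compatible_reaching out)[A]]; exists A.
exists L, A; split=> [l|X]; first by have [] := AP l.
apply/seteqP; split=> [x fXx|x [l _]].
- by exists (exist _ (X, x) fXx) => //; have [] := AP (exist _ (X, x) fXx).
- by apply: compatible_elementary_sub => //; have [] := AP l.
Qed.
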